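(* Let $K$ be a finite field with $q$ elements, let $s\geq 1$, and let $w_1,\dots,w_s$ be positive integers with $\gcd(w_1,\dots,w_s)=1$. Let $I_{\mathbb{T}}\subset K[t_1,\dots,t_s]$ be the vanishing ideal of the weighted projective torus $\mathbb{T}(w_1,\dots,w_s)$. Let $Q=\langle w_1,\dots,w_s\rangle\subset\mathbb{N}$ and let $G=\mathbb{N}\setminus Q$. Then the Hilbert series of $K[t_1,\dots,t_s]/I_{\mathbb{T}}$ is given by $$H_{\mathbb{T}}(t)=\frac{\Bigl(\frac{1}{1-t^{q-1}}-\sum_{a\in G}t^{a(q-1)}\Bigr)\prod_{i=1}^s\bigl(1-t^{w_i(q-1)}\bigr)}{\prod_{i=1}^s(1-t^{w_i})}.$$
   Context: $\mathbb{N}=\{0,1,2,\dots\}$. The weighted projective space $\mathbb{P}(w_1,\dots,w_s)$ is the quotient $(K^s\setminus 0)/K^*$, where $\lambda\in K^*$ acts by $\lambda(x_1,\dots,x_s)=(\lambda^{w_1}x_1,\dots,\lambda^{w_s}x_s)$. The weighted projective torus is $\mathbb{T}(w_1,\dots,w_s)=\{(x_1,\dots,x_s)\in\mathbb{P}(w_1,\dots,w_s): x_1\cdots x_s\neq 0\}$. The polynomial ring $K[t_1,\dots,t_s]$ is graded by $\deg(t_i)=w_i$. The vanishing ideal of a set $X\subset\mathbb{P}(w_1,\dots,w_s)$ is the ideal of $K[t_1,\dots,t_s]$ generated by all homogeneous polynomials (for this grading) that vanish on $X$. $Q=\langle w_1,\dots,w_s\rangle$ is the submonoid of $\mathbb{N}$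 generated by $w_1,\dots,w_s$; since $\gcd(w_1,\dots,w_s)=1$ it is a numerical semigroup, i.e. its set of gaps $G=\mathbb{N}\setminus Q$ is finite. The Hilbert series of a finitely generated graded $K[t_1,\dots,t_s]$-module $M$ is $H_M(t)=\sum_{d=0}^\infty(\dim_K M_d)\,t^d$; here it is taken for $M=K[t_1,\dots,t_s]/I_{\mathbb{T}}$ with the grading induced by $\deg(t_i)=w_i$ for $i=1,\dots,s$. *)

(* Defs.v *)
From HB Require Import structures.
From mathcomp Require Import all_boot all_order all_algebra.
From mathcomp Require Import generic_quotient ring_quotient.
From mathcomp Require Import boolp classical_sets fsbigop.
From mathcomp Require Import mpoly.

Set Implicit Arguments.
Unset Strict Implicit.
Unset Printing Implicit Defensive.

Import GRing.Theory.

Local Open Scope ring_scope.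
Local Open Scope classical_set_scope.
Local Open Scope quotient_scope.

Record fps (R : Type) := FPS { coefps : nat -> R }.

HB.instance Definition _ (R : Type) := gen_eqMixin (fps R).
HB.instance Definition _ (R : Type) := gen_choiceMixin (fps R).

Lemma fpsP (R : Type) (f g : fps R) : coefps f =1 coefps g -> f = g.
Proof. by case: f g => [f] [g] /= /funext ->. Qed.

Section FpsRing.
Variable R : comNzRingType.
Implicit Types f g h : fps R.

Definition fps_zero : fps R := FPS (fun=> 0).
Definition fps_opp f : fps R := FPS (fun n => - coefps f n).
Definition fps_add f g : fps R := FPS (fun n => coefps f n + coefps g n).
Definition fps_one : fps R := FPS (fun n => (n == 0%N)%:R).
Definition fps_mul f g : fps R :=
  FPS (fun n => \sum_(j < n.+1) coefps f j * coefps g (n - j)).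

Lemma fps_addA : associative fps_add.
Proof. by move=> f g h; apply: fpsP => n /=; rewrite addrA. Qed.
Lemma fps_addC : commutative fps_add.
Proof. by move=> f g; apply: fpsP => n /=; rewrite addrC. Qed.
Lemma fps_add0 : left_id fps_zero fps_add.
Proof. by move=> f; apply: fpsP => n /=; rewrite add0r. Qed.
Lemma fps_addN : left_inverse fps_zero fps_opp fps_add.
Proof. by move=> f; apply: fpsP => n /=; rewrite addNr. Qed.

HB.instance Definition _ :=
  GRing.isZmodule.Build (fps R) fps_addA fps_addC fps_add0 fps_addN.

Let trunc N f : {poly R} := \poly_(i < N) coefps f i.

Let coef_trunc_mul N f g n :
  (n < N)%N -> (trunc N f * trunc N g)`_n = coefps (fps_mul f g) n.
Proof.
move=> ltnN; rewrite coefM; apply: eq_bigr => j _.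
have ltjN : (j < N)%N by rewrite (leq_trans _ ltnN) // ltn_ord.
by rewrite !coef_poly ltjN (leq_ltn_trans (leq_subr _ _) ltnN).
Qed.

Lemma fps_mulC : commutative fps_mul.
Proof.
by move=> f g; apply: fpsP => n; rewrite -!(@coef_trunc_mul n.+1) // mulrC.
Qed.

Lemma fps_mulA : associative fps_mul.
Proof.
move=> f g h; apply: fpsP => n.
have E f1 f2 (p : {poly R}) :
    (trunc n.+1 (fps_mul f1 f2) * p)`_n = (trunc n.+1 f1 * trunc n.+1 f2 * p)`_n.
  rewrite !coefM; apply: eq_bigr => j _.
  by rewrite coef_poly ltn_ord -(@coef_trunc_mul n.+1) // ltn_ord.
rewrite [in LHS]fps_mulC -!(@coef_trunc_mul n.+1) // !E.
by rewrite mulrC mulrA.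
Qed.

Lemma fps_mul1 : left_id fps_one fps_mul.
Proof.
move=> f; apply: fpsP => n /=; rewrite big_ord_recl /= mul1r subn0.
by rewrite big1 ?addr0 // => j _; rewrite mul0r.
Qed.

Lemma fps_mulDl : left_distributive fps_mul fps_add.
Proof.
move=> f g h; apply: fpsP => n /=; rewrite -big_split /=.
by apply: eq_bigr => j _; rewrite mulrDl.
Qed.

Lemma fps_oner_neq0 : fps_one != 0.
Proof.
apply/eqP => /(congr1 (fun f => coefps f 0%N)) /= /eqP.
by rewrite oner_eq0.
Qed.

HB.instance Definition _ := GRing.Zmodule_isComNzRing.Build (fps R)
  fps_mulA fps_mulC fps_mul1 fps_mulDl fps_oner_neq0.

(* As everywhere in the library, a non-unit is its own inverse. *)
Definition fps_unit : pred (fps R) := fun f => `[< exists g, g * f = 1 >].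
Definition fps_inv f : fps R := xget f [set g | g * f = 1].

Lemma fps_mulV : {in fps_unit, left_inverse 1 fps_inv *%R}.
Proof.
by move=> f /asboolP [g gf]; rewrite /fps_inv; case: xgetP => // /(_ g).
Qed.
Lemma fps_unitP f g : g * f = 1 -> fps_unit f.
Proof. by move=> gf; apply/asboolP; exists g. Qed.
Lemma fps_inv_out : {in [predC fps_unit], fps_inv =1 id}.
Proof.
move=> f /asboolP nf; rewrite /fps_inv; case: xgetP => // g _ gf.
by case: nf; exists g.
Qed.

HB.instance Definition _ := GRing.ComNzRing_hasMulInverse.Build (fps R)
  fps_mulV fps_unitP fps_inv_out.

Definition fpsX : fps R := FPS (fun n => (n == 1%N)%:R).

End FpsRing.

(* A join of GRing.SubmodClosed and GRing.ZmodClosed cannot be inserted in the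
   library hierarchy, hence a separate mixin for stability under scaling. *)
HB.mixin Record isScaleStable (K : pzRingType) (V : lmodType K) (S : V -> bool) :=
  { scale_stable_subproof : scaler_closed S }.

#[short(type="subspaceClosed")]
HB.structure Definition SubspaceClosed (K : pzRingType) (V : lmodType K) :=
  {S of GRing.ZmodClosed V S & isScaleStable K V S}.

Section QuotientLmodule.
Variables (K : pzRingType) (V : lmodType K) (U : subspaceClosed V).
Local Notation quot := (Quotient.quot U).

Definition quot_scale (a : K) (x : quot) : quot := \pi_quot (a *: repr x).

Lemma quot_scale_pi a (v : V) : quot_scale a (\pi_quot v) = \pi_quot (a *: v).
Proof.
apply/eqP; rewrite -Quotient.idealrBE -scalerBr; apply: scale_stable_subproof.
by rewrite Quotient.idealrBE reprK.
Qed.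

Lemma quot_scaleA a b x : quot_scale a (quot_scale b x) = quot_scale (a * b) x.
Proof. by elim/quotW: x => v; rewrite (quot_scale_pi b) !quot_scale_pi scalerA. Qed.

Lemma quot_scale1 : left_id 1 quot_scale.
Proof. by elim/quotW => v; rewrite quot_scale_pi scale1r. Qed.

Lemma quot_scaleDr : right_distributive quot_scale +%R.
Proof.
move=> a; elim/quotW => u; elim/quotW => v.
by rewrite -raddfD !quot_scale_pi -raddfD scalerDr.
Qed.

Lemma quot_scaleDl x : {morph quot_scale^~ x : a b / a + b}.
Proof.
by move=> a b; elim/quotW: x => v; rewrite !quot_scale_pi -raddfD scalerDl.
Qed.

HB.instance Definition _ := GRing.Zmodule_isLmodule.Build K quot
  quot_scaleA quot_scale1 quot_scaleDr quot_scaleDl.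

Lemma quot_piZ a (v : V) : \pi_quot (a *: v) = a *: \pi_quot v.
Proof. by rewrite -quot_scale_pi. Qed.

End QuotientLmodule.

Section IdealGen.
Variable R : comNzRingType.

Definition ideal_gen (A : set R) : {pred R} := fun f =>
  `[< exists (n : nat) (g h : 'I_n -> R),
        (forall j, A (h j)) /\ f = \sum_(j < n) g j * h j >].

Lemma ideal_genMl A a f : f \in ideal_gen A -> a * f \in ideal_gen A.
Proof.
move=> /asboolP [n [g [h [Ah ->]]]]; apply/asboolP.
exists n, (fun j => a * g j), h; split=> //.
by rewrite mulr_sumr; apply: eq_bigr => j _; rewrite mulrA.
Qed.

Lemma ideal_gen_zmod_closed A : zmod_closed (ideal_gen A).
Proof.
split; first by apply/asboolP; exists 0%N, (fun=> 0), (fun=> 0); split;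
  [case | rewrite big_ord0].
move=> f1 f2 /asboolP [n1 [g1 [h1 [A1 ->]]]] /asboolP [n2 [g2 [h2 [A2 ->]]]].
apply/asboolP; exists (n1 + n2)%N.
exists (fun j => match split j with inl a => g1 a | inr b => - g2 b end).
exists (fun j => match split j with inl a => h1 a | inr b => h2 b end).
split; first by move=> j; case: (split j).
rewrite big_split_ord -sumrN /=; congr (_ + _); apply: eq_bigr => j _.
  by rewrite -[lshift _ _]/(unsplit (inl j)) unsplitK.
by rewrite -[rshift _ _]/(unsplit (inr j)) unsplitK mulNr.
Qed.

HB.instance Definition _ A :=
  GRing.isZmodClosed.Build R (ideal_gen A) (ideal_gen_zmod_closed A).

End IdealGen.

Lemma ideal_gen_scaler_closed (K : fieldType) (R : comAlgType K) (A : set R) :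
  scaler_closed (ideal_gen A).
Proof. by move=> a f fI; rewrite -mulr_algl; apply: ideal_genMl. Qed.

HB.instance Definition _ (K : fieldType) (R : comAlgType K) (A : set R) :=
  isScaleStable.Build K R (ideal_gen A) (@ideal_gen_scaler_closed K R A).

Section Dimension.
Variables (K : fieldType) (V : lmodType K).

Definition is_basis (U : set V) (n : nat) (b : 'I_n -> V) : Prop :=
  [/\ forall i, U (b i),
      forall v, U v -> exists c : 'I_n -> K, v = \sum_(i < n) c i *: b i
    & forall c : 'I_n -> K, \sum_(i < n) c i *: b i = 0 -> forall i, c i = 0].

(* 0 by convention when U has no finite basis *)
Definition dimension (U : set V) : nat :=
  xget 0%N [set n | exists b : 'I_n -> V, is_basis U b].

End Dimension.

Section WeightedProjectiveSpace.
Variables (K : finFieldType) (s : nat) (w : 'I_s -> nat).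

Definition punctured := {x : {ffun 'I_s -> K} | x != 0}.

Definition wequiv (x y : punctured) : bool :=
  [exists l : K, (l != 0) && [forall i, val y i == l ^+ w i * val x i]].

Lemma wequiv_equiv : equiv_class_of wequiv.
Proof.
have tr : forall y x z, wequiv x y -> wequiv y z -> wequiv x z.
  move=> y x z /existsP [l /andP [l0 /forallP xy]].
  move=> /existsP [m /andP [m0 /forallP yz]].
  apply/existsP; exists (m * l); rewrite mulf_neq0 //=; apply/forallP => i.
  by rewrite (eqP (yz i)) (eqP (xy i)) exprMn mulrA.
have sy : forall x y, wequiv x y -> wequiv y x.
  move=> x y /existsP [l /andP [l0 /forallP xy]].
  apply/existsP; exists l^-1; rewrite invr_neq0 //=; apply/forallP => i.
  by rewrite (eqP (xy i)) exprVn mulKf // expf_neq0.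
split=> [x|x y|y x z]; last exact: tr.
- apply/existsP; exists 1; rewrite oner_neq0 /=; apply/forallP => i.
  by rewrite expr1n mul1r.
- by apply/idP/idP; apply: sy.
Qed.

Canonical wequiv_rel := EquivRelPack wequiv_equiv.
Canonical wequiv_enc := defaultEncModRel wequiv.

Definition wproj := {eq_quot wequiv}.

Definition wtorus : set wproj :=
  [set p | exists2 x : punctured, p = \pi_wproj x & \prod_(i < s) val x i != 0].

Definition wdeg (m : 'X_{1..s}) : nat := \sum_(i < s) (w i * m i)%N.

Definition whomog (d : nat) (f : {mpoly K[s]}) : Prop :=
  forall m, m \in msupp f -> wdeg m = d.

(* Only used for f homogeneous: then f.@[val x] = 0 depends only on the class of
   x in the weighted projective space. *)
Definition vanishes_on (f : {mpoly K[s]}) (X : set wproj) : Prop :=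
  forall x : punctured, X (\pi_wproj x) -> f.@[val x] = 0.

Definition vanishing_generators (X : set wproj) : set {mpoly K[s]} :=
  [set f | (exists d, whomog d f) /\ vanishes_on f X].

Definition vanishing_ideal (X : set wproj) : {pred {mpoly K[s]}} :=
  ideal_gen (vanishing_generators X).

HB.instance Definition _ X := SubspaceClosed.on (vanishing_ideal X).

Definition coordinate_ring (X : set wproj) : lmodType K :=
  {ideal_quot (vanishing_ideal X)}.

Definition graded_piece (X : set wproj) (d : nat) : set (coordinate_ring X) :=
  [set \pi_({ideal_quot (vanishing_ideal X)}) f | f in whomog d].

Definition hilbert_series (X : set wproj) : fps int :=
  FPS (fun d => (dimension (@graded_piece X d))%:Z).

End WeightedProjectiveSpace.

Arguments wproj K {s} w.
Arguments wtorus K {s} w.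

Definition semigroup_gen (s : nat) (w : 'I_s -> nat) : set nat :=
  [set n | exists c : 'I_s -> nat, n = (\sum_(i < s) c i * w i)%N].

Definition gaps (s : nat) (w : 'I_s -> nat) : set nat := ~` semigroup_gen w.

(* Main.v *)
Require Import Defs.
From HB Require Import structures.
From mathcomp Require Import all_boot all_order all_algebra.
From mathcomp Require Import generic_quotient ring_quotient.
From mathcomp Require Import finfield zify.
From mathcomp Require Import boolp classical_sets cardinality fsbigop.
From mathcomp Require Import mpoly.

(* The evaluations on (K^* )^s of two monomials agree exactly when their exponents
   are congruent modulo q - 1, and distinct classes give linearly independent
   functions. So the dimension in degree d is the number of r in [0, q - 1)^s
   lying in the class of some monomial of degree d, that is, such that
   d = sum_i w_i r_i + (q - 1) a with a in Q. Hence the Hilbert series is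
     (sum_{a in Q} t^(a (q - 1))) * prod_i (sum_{r < q - 1} t^(w_i r)). *)

Set Implicit Arguments.
Unset Strict Implicit.
Unset Printing Implicit Defensive.

Import GRing.Theory.

Local Open Scope ring_scope.
Local Open Scope classical_set_scope.

(** * Power sums and characters over the units of a finite field *)

Lemma expf_card_pred (K : finFieldType) (x : K) : x != 0 -> x ^+ (#|K| - 1) = 1.
Proof.
move=> x0; apply: (mulfI x0); rewrite -exprS mulr1 subn1 prednK ?expf_card //.
by rewrite (leq_trans _ (card_finNzRing_gt1 K)).
Qed.

Lemma expf_mod_card (K : finFieldType) (x : K) e :
  x != 0 -> x ^+ (e %% (#|K| - 1)) = x ^+ e.
Proof.
move=> x0; rewrite [in RHS](divn_eq e (#|K| - 1)) exprD mulnC exprM.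
by rewrite expf_card_pred // expr1n mul1r.
Qed.

(** Translation by 1 permutes [K], so it preserves the sum of all elements while adding [#|K|] to
    it. *)
Lemma natr_card_finField (K : finFieldType) : #|K|%:R = 0 :> K.
Proof.
apply: (addrI (\sum_(x : K) x)); rewrite addr0 -sumr_const -big_split /=.
by rewrite [RHS](reindex_inj (addIr 1)).
Qed.

Lemma sum_units_expf (K : finFieldType) e :
  \sum_(x : K | x != 0) x ^+ e = if (#|K| - 1 %| e)%N then -1 else 0.
Proof.
have q1 := card_finNzRing_gt1 K.
case: ifP => [dv|/negbT ndv].
  rewrite (eq_bigr (fun=> 1)) => [|x x0]; last first.
    by rewrite -expf_mod_card // (eqP dv) expr0.
  rewrite sumr_const (_ : #|_| = #|K| - 1)%N; last first.
    by rewrite subn1 -(cardC1 (0 : K)); apply: eq_card => x; rewrite !inE.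
  by rewrite natrB ?natr_card_finField ?sub0r // ltnW.
set k := (e %% (#|K| - 1))%N.
have k0 : (0 < k)%N by rewrite lt0n.
have kq : (k < #|K| - 1)%N by rewrite ltn_mod subn_gt0.
(* ['X^k - 1] has at most [k < #|K| - 1] roots, too few to contain all units. *)
have [x x0 xk] : exists2 x : K, x != 0 & x ^+ k != 1.
  apply/exists_inP; rewrite -negb_forall_in; apply/negP => /forall_inP nx.
  have p0 : 'X^k - 1 != 0 :> {poly K} by rewrite -size_poly_gt0 size_XnsubC.
  have := max_poly_roots p0 (rs := enum (predC1 (0 : K))) _ (enum_uniq _).
  rewrite size_XnsubC // -cardE cardC1 -subn1 ltnNge kq => H.
  suff /H : all (root ('X^k - 1)) (enum (predC1 (0 : K))) by [].
  apply/allP => x; rewrite mem_enum !inE => /nx.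
  by rewrite rootE !hornerE => /eqP ->; rewrite subrr.
set S := \sum_(x | _) _.
(* Multiplication by [x] permutes the units; since [x ^+ k] is not 1, this forces [S = 0]. *)
have SE : S = x ^+ k * S.
  rewrite {1}/S (reindex_inj (mulfI x0)) /= mulr_sumr.
  apply: eq_big => [y|y]; first by rewrite mulf_eq0 (negPf x0).
  by rewrite exprMn expf_mod_card.
apply/eqP; move/eqP: SE; rewrite -subr_eq0 -{1}(mul1r S) -mulrBl mulf_eq0.
by rewrite subr_eq0 eq_sym (negPf xk).
Qed.

(* Orthogonality of the characters of (K^* )^s. *)
Lemma monomials_free (K : finFieldType) (s : nat)
    (c : {ffun 'I_s -> 'I_(#|K| - 1)} -> K) :
  (forall x : 'I_s -> K, (forall i, x i != 0) ->
     \sum_r c r * \prod_i x i ^+ r i = 0) ->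
  forall r, c r = 0.
Proof.
move=> c0 r0.
(* The relation is paired with the inverse of the character [r0]: the exponent [#|K| - 1 - r0 i]
   represents [- r0 i] modulo [#|K| - 1] and is a natural number. *)
have : \sum_(x in ffun_on (fun y : K => y != 0)) (\prod_i x i ^+ (#|K| - 1 - r0 i))
    * (\sum_r c r * \prod_i (x : {ffun 'I_s -> K}) i ^+ r i) = 0.
  apply: big1 => x /ffun_onP xn0; rewrite c0 ?mulr0 // => i; exact: xn0.
under eq_bigr => x _ do rewrite mulr_sumr.
rewrite exchange_big /= (bigD1 r0) //= [X in _ + X]big1 => [|r rr0].
  rewrite addr0 => E0; apply/eqP; move/eqP: E0.
  under eq_bigr => x _ do rewrite mulrCA -big_split /=.
  rewrite -mulr_sumr -(bigA_distr_big _ (fun i y => y ^+ _ * y ^+ _)).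
  (* In the diagonal term each factor is the sum of [y ^+ (#|K| - 1)] over the units, that is -1, so
     the product cannot vanish and [c r0] must. *)
  rewrite mulf_eq0 => /orP[//|]; rewrite (eq_bigr (fun=> -1)) => [|i _].
    by rewrite prodr_const expf_eq0 oppr_eq0 oner_eq0 andbF.
  under eq_bigr => y _ do rewrite -exprD subnK ?(ltnW (ltn_ord _)) //.
  by rewrite sum_units_expf dvdnn.
under eq_bigr => x _ do rewrite mulrCA -big_split /=.
rewrite -mulr_sumr -(bigA_distr_big _ (fun i y => y ^+ _ * y ^+ _)).
have [i ri] : exists i, r i != r0 i.
  apply/existsP; apply: contraR rr0; rewrite negb_exists => /forallP r_eq.
  by apply/eqP/ffunP => i; apply/eqP/negPn/r_eq.
rewrite (bigD1 i) //=.
under eq_bigr => y _ do rewrite -exprD.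
rewrite sum_units_expf ifN ?mul0r ?mulr0 //.
apply: contra ri => /dvdnP[k E]; rewrite -val_eqE /=; apply/eqP.
(* The number [p - b + a] lies strictly between 0 and [2 * p], so as a multiple of [p] it equals
   [p]. *)
have nat_eq (p a b : nat) : (a < p)%N -> (b < p)%N ->
  (p - b + a = k * p)%N -> a = b.
  by case: k {E} => [|[|k]]; nia.
exact: nat_eq E.
Qed.

(** * Invariance of the dimension and bases of quotients *)

Lemma is_basis_leq (K : fieldType) (V : lmodType K) (U : set V) n m
    (b : 'I_n -> V) (b' : 'I_m -> V) :
  is_basis U b -> is_basis U b' -> (n <= m)%N.
Proof.
case=> Ub gen_b free_b [Ub' gen_b' _].
have [A bE] := choice (fun i => gen_b' _ (Ub i)).
have [B b'E] := choice (fun j => gen_b _ (Ub' j)).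
(* Freeness of [b] makes the product of the two transition matrices the identity of size [n], and
   its factorisation through size [m] forces [n <= m]. *)
apply: (@mulmx1_min K _ _ (\matrix_(i, j) A i j) (\matrix_(j, k) B j k)).
apply/matrixP => i k; rewrite !mxE; apply/eqP; rewrite -subr_eq0; apply/eqP.
move: k; apply: free_b; under eq_bigr => k _ do rewrite scalerBl scaler_suml.
rewrite sumrB exchange_big /= [X in _ - X](bigD1 i) //= eqxx scale1r.
rewrite [X in _ - (_ + X)]big1 ?addr0 => [|k ki]; last first.
  by rewrite eq_sym (negPf ki) scale0r.
apply/eqP; rewrite subr_eq0 [X in _ == X]bE; apply/eqP/eq_bigr => j _.
rewrite [in RHS]b'E scaler_sumr; apply: eq_bigr => k _.
by rewrite !mxE scalerA.
Qed.

Lemma dimension_basis (K : fieldType) (V : lmodType K) (U : set V) n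
    (b : 'I_n -> V) : is_basis U b -> dimension U = n.
Proof.
move=> bb; rewrite /dimension; case: xgetP => [m _ [b' bb']|/(_ n)[]]; last by exists b.
by apply/eqP; rewrite eqn_leq (is_basis_leq bb' bb) (is_basis_leq bb bb').
Qed.

Section QuotientMap.
Local Open Scope quotient_scope.
Variables (K : fieldType) (V : lmodType K) (U : subspaceClosed V).

Lemma is_basis_quot (W : set V) n (b : 'I_n -> V) :
  (forall i, W (b i)) ->
  (forall v, W v -> exists c : 'I_n -> K, v - \sum_(i < n) c i *: b i \in U) ->
  (forall c : 'I_n -> K, \sum_(i < n) c i *: b i \in U -> forall i, c i = 0) ->
  is_basis [set \pi_(Quotient.quot U) v | v in W]
    (fun i => \pi_(Quotient.quot U) (b i)).
Proof.
have piE u v : u - v \in U -> \pi_(Quotient.quot U) u = \pi_(Quotient.quot U) v.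
  by rewrite Quotient.idealrBE => /eqP.
have pi_sum (c : 'I_n -> K) : \sum_(i < n) c i *: \pi_(Quotient.quot U) (b i) =
    \pi_(Quotient.quot U) (\sum_(i < n) c i *: b i).
  by rewrite raddf_sum; apply: eq_bigr => i _; apply/esym/quot_piZ.
move=> Wb gen_b free_b; split=> [i | _ [v Wv <-] | c].
- by exists (b i).
- by have [c vc] := gen_b v Wv; exists c; rewrite pi_sum; apply: piE.
rewrite pi_sum => c0; apply: free_b.
by rewrite -[X in X \in U]subr0 Quotient.idealrBE c0 raddf0.
Qed.

End QuotientMap.

Section VanishingIdeal.
Local Open Scope quotient_scope.
Variables (K : finFieldType) (s : nat) (w : 'I_s -> nat).
Hypothesis hs : (1 <= s)%N.

Let T : set (wproj K w) := wtorus K w.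

Lemma dimension_graded_piece_basis d n (b : 'I_n -> {mpoly K[s]}) :
  (forall i, whomog w d (b i)) ->
  (forall f, whomog w d f -> exists c : 'I_n -> K,
     f - \sum_(i < n) c i *: b i \in vanishing_ideal T) ->
  (forall c : 'I_n -> K,
     \sum_(i < n) c i *: b i \in vanishing_ideal T -> forall i, c i = 0) ->
  dimension (@graded_piece K s w T d) = n.
Proof.
move=> b_deg gen_b free_b.
have bb := is_basis_quot (U := vanishing_ideal T) b_deg gen_b free_b.
exact: (dimension_basis bb).
Qed.

(** Two representatives differ coordinatewise by the nonzero factors [l ^+ w i], so having no zero
    coordinate does not depend on the representative. *)
Lemma wtorus_pi (x : punctured K s) :
  T (\pi_(wproj K w) x) <-> forall i, val x i != 0.
Proof.
split=> [[y /eqmodP xy y0] i | x0]; last first.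
  by exists x => //; apply/prodf_neq0 => i _; apply: x0.
have /existsP[l /andP[l0 /forallP /(_ i) /eqP yi]] : wequiv w x y := xy.
have /prodf_neq0 /(_ i isT) := y0.
by rewrite yi mulf_eq0 negb_or => /andP[].
Qed.

Lemma vanishes_on_wtorus (f : {mpoly K[s]}) :
  vanishes_on f T <-> forall x : 'I_s -> K, (forall i, x i != 0) -> f.@[x] = 0.
Proof.
split=> [fT x x0|f0 x /wtorus_pi]; last exact: f0.
pose y : {ffun 'I_s -> K} := [ffun i => x i].
have y0 : y != 0.
  (* As [s] is positive there is a coordinate 0; it is nonzero, so [y] does represent a projective
     point. *)
  apply/eqP => /ffunP/(_ (Ordinal hs)); rewrite !ffunE => /eqP.
  by rewrite (negPf (x0 _)).
rewrite -(fT (exist _ y y0)); first by apply: meval_eq => i; rewrite /= ffunE.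
by apply/wtorus_pi => i; rewrite /= ffunE.
Qed.

Lemma vanishing_ideal_eval (f : {mpoly K[s]}) (x : 'I_s -> K) :
  f \in vanishing_ideal T -> (forall i, x i != 0) -> f.@[x] = 0.
Proof.
move=> /asboolP[n [g [h [hT ->]]]] x0; rewrite raddf_sum big1 // => j _.
by have [_ /vanishes_on_wtorus h0] := hT j; rewrite /= mevalM h0 // mulr0.
Qed.

Lemma vanishing_ideal_homog (f : {mpoly K[s]}) d : whomog w d f ->
  (forall x : 'I_s -> K, (forall i, x i != 0) -> f.@[x] = 0) ->
  f \in vanishing_ideal T.
Proof.
move=> fd f0; apply/asboolP; exists 1%N, (fun=> 1), (fun=> f).
split; last by rewrite big_ord1 mul1r.
by move=> _; split; [exists d | apply/vanishes_on_wtorus].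
Qed.

End VanishingIdeal.

(** * The Hilbert function of the torus *)

Lemma whomogE (K : finFieldType) (s : nat) (w : 'I_s -> nat) d (f : {mpoly K[s]}) :
  whomog w d f <-> forall m, wdeg w m != d -> f@_m = 0.
Proof.
split=> f_d m; first by move=> md; apply/memN_msupp_eq0; apply: contra md => /f_d ->.
by rewrite mcoeff_msupp; apply: contraNeq => /f_d ->.
Qed.

(** The numbers [c i * p + r i] are the exponents of a monomial of weighted degree [d] that reduces
    to [r] modulo [p]. *)
Definition attained_residues (p s d : nat) (w : 'I_s -> nat) : {set {ffun 'I_s -> 'I_p}} :=
  [set r : {ffun 'I_s -> 'I_p} |
    `[< exists c : 'I_s -> nat, d = \sum_i (w i * (c i * p + r i))%N >]]%SET.

Lemma dimension_graded_piece (K : finFieldType) (s : nat) (w : 'I_s -> nat) d :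
  (1 <= s)%N ->
  dimension (@graded_piece K s w (wtorus K w) d) = #|attained_residues (#|K| - 1) d w|.
Proof.
move=> hs; set p := (#|K| - 1)%N; set T := wtorus K w; set A := attained_residues p d w.
have p0 : (0 < p)%N by rewrite subn_gt0 card_finNzRing_gt1.
have expf_p (x : K) e : x != 0 -> x ^+ (e %% p) = x ^+ e by exact: expf_mod_card.
have /choice[c cE] : forall r, exists c : 'I_s -> nat,
    r \in A -> d = (\sum_i w i * (c i * p + r i))%N.
  move=> r; have [|] := boolP (r \in A); last by exists (fun=> 0%N).
  by rewrite inE => /asboolP[c dE]; exists c.
(* The chosen representative of the class [r]; it has degree [d] only for [r] in [A]. *)
pose mon r : 'X_{1..s} := [multinom (c r i * p + (r : {ffun 'I_s -> 'I_p}) i)%N | i < s].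
have mon_deg r : r \in A -> wdeg w (mon r) = d.
  move=> /cE ->; apply: eq_bigr => i _; by rewrite mnmE.
have mon_eval r (x : 'I_s -> K) : (forall i, x i != 0) ->
    'X_[mon r].@[x] = \prod_i x i ^+ r i.
  move=> x0; rewrite mevalX; apply: eq_bigr => i _; rewrite mnmE.
  by rewrite -[LHS]expf_p // modnMDl modn_small.
pose res (m : 'X_{1..s}) : {ffun 'I_s -> 'I_p} :=
  [ffun i => Ordinal (ltn_pmod (m i) p0)].
have res_eval m (x : 'I_s -> K) : (forall i, x i != 0) ->
    'X_[m].@[x] = \prod_i x i ^+ res m i.
  by move=> x0; rewrite mevalX; apply: eq_bigr => i _; rewrite ffunE expf_p.
have res_att m : wdeg w m = d -> res m \in A.
  move=> md; rewrite inE; apply/asboolP; exists (fun i => m i %/ p)%N.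
  by rewrite -md; apply: eq_bigr => i _; rewrite ffunE /= -divn_eq.
pose b (i : 'I_#|A|) : {mpoly K[s]} := 'X_[mon (enum_val i)].
have b_deg i : whomog w d (b i).
  by move=> m; rewrite msuppX inE => /eqP ->; rewrite mon_deg ?enum_valP.
have b_eval i (x : 'I_s -> K) : (forall i, x i != 0) ->
    (b i).@[x] = \prod_j x j ^+ (enum_val i : {ffun 'I_s -> 'I_p}) j.
  by move=> x0; rewrite mon_eval ?enum_valP.
apply: (dimension_graded_piece_basis b_deg).
  have coef0 (f : {mpoly K[s]}) (fd : whomog w d f) := proj1 (whomogE w d f) fd.
  (* All terms of [f] in one residue class are merged into a single coefficient on the
     representative of that class. *)
  move=> f fd; exists (fun i => \sum_(m <- msupp f | res m == enum_val i) f@_m).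
  apply: (vanishing_ideal_homog hs (d := d)).
    apply/whomogE => m md; rewrite mcoeffB (coef0 _ fd) // raddf_sum big1 ?subr0 //.
    by move=> i _; rewrite /= mcoeffZ (coef0 _ (b_deg i)) ?mulr0.
  move=> x x0; apply/eqP; rewrite mevalB subr_eq0 mevalE big_seq.
  rewrite (partition_big res (mem A)) => [|m /fd]; last exact: res_att.
  rewrite big_enum_val raddf_sum; apply/eqP/eq_bigr => i _ /=.
  rewrite mevalZ b_eval // mulr_suml [RHS]big_seq_cond.
  apply: eq_bigr => m /andP[_ /eqP <-].
  by rewrite -res_eval // mevalX.
move=> c' cU i.
(* The coefficients are extended by 0 outside [A], since [monomials_free] ranges over all residue
   vectors; matching on the reflection keeps the membership proof that [enum_rank_in] needs. *)
pose e r := if r \in A =P true is ReflectT rA then c' (enum_rank_in rA r) else 0.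
have eE j : e (enum_val j) = c' j.
  by rewrite /e; case: eqP => [rA|]; rewrite ?enum_valK_in // enum_valP.
rewrite -eE; apply: monomials_free => x x0.
rewrite -[RHS](vanishing_ideal_eval hs cU x0) raddf_sum (bigID (mem A)) /=.
rewrite [X in _ + X]big1 ?addr0 => [|r rA]; last first.
  by rewrite /e; case: eqP => [rA'|_]; rewrite ?mul0r //; rewrite rA' in rA.
rewrite big_enum_val; apply: eq_bigr => j _.
by rewrite eE mevalZ b_eval.
Qed.

(** * Finiteness of the gaps of the semigroup *)

Lemma semigroup_gen0 (s : nat) (w : 'I_s -> nat) : semigroup_gen w 0%N.
Proof. by exists (fun=> 0%N); rewrite big1. Qed.

Lemma semigroup_genD (s : nat) (w : 'I_s -> nat) a b :
  semigroup_gen w a -> semigroup_gen w b -> semigroup_gen w (a + b)%N.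
Proof.
move=> [c ->] [c' ->]; exists (fun i => c i + c' i)%N.
by rewrite -big_split; apply: eq_bigr => i _; rewrite mulnDl.
Qed.

Lemma semigroup_genM (s : nat) (w : 'I_s -> nat) k a :
  semigroup_gen w a -> semigroup_gen w (k * a)%N.
Proof.
move=> [c ->]; exists (fun i => k * c i)%N.
by rewrite big_distrr; apply: eq_bigr => i _; rewrite /= mulnA.
Qed.

(** Bezout's identity without subtraction: the gcd is realised as a difference of two elements of
    the semigroup, by induction over the gcd. *)
Lemma semigroup_gen_gcd (s : nat) (w : 'I_s -> nat) :
  exists2 b, semigroup_gen w b & semigroup_gen w (b + \big[gcdn/0%N]_(i < s) w i)%N.
Proof.
elim/big_ind: _ => [|x y [a Qa Qax] [b Qb Qby]|i _].
- by exists 0%N; rewrite ?addn0; apply: semigroup_gen0.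
- have [->|x0] := posnP x; first by exists b; rewrite ?gcd0n.
  case: (egcdnP y x0) => u v uv _.
  (* Since [u * x = v * y + gcdn x y], adding the gcd to this witness gives
     [u * (a + x) + v * b]. *)
  exists (u * a + v * (b + y))%N.
    by apply: semigroup_genD; apply: semigroup_genM.
  rewrite (_ : _ + _ = u * (a + x) + v * b)%N; last by nia.
  by apply: semigroup_genD; apply: semigroup_genM.
exists 0%N; first exact: semigroup_gen0.
exists (fun j => (j == i) : nat).
by rewrite (bigD1 i) //= eqxx mul1n big1 ?addn0 // => j /negPf ->.
Qed.

Lemma finite_gaps (s : nat) (w : 'I_s -> nat) :
  \big[gcdn/0%N]_(i < s) w i = 1%N -> finite_set (gaps w).
Proof.
move=> w1; have [b Qb] := semigroup_gen_gcd w; rewrite w1 => Qb1.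
apply: (@sub_finite_set _ _ `I_(b * b).+1); last exact: finite_II.
move=> n /=; rewrite ltnNge => nQ; apply/negP => bn; apply: nQ.
have [b0|b0] := posnP b.
  by rewrite -(muln1 n); apply: semigroup_genM; rewrite b0 in Qb1.
(* Past [b * b] the quotient [n %/ b] is at least [b], hence exceeds the remainder, so [n] is a
   combination of [b] and [b + 1] with natural coefficients. *)
rewrite (_ : n = n %% b * (b + 1) + (n %/ b - n %% b) * b)%N.
  by apply: semigroup_genD; apply: semigroup_genM.
have := divn_eq n b; have := ltn_pmod n b0.
have : (b <= n %/ b)%N by rewrite leq_divRL // ltnW.
by move: (n %% b)%N (n %/ b)%N => r k; nia.
Qed.

(** * Formal power series and geometric series *)

Section FpsTheory.
Variable R : comNzRingType.
Local Notation t := (fpsX R).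

Lemma coefps_sum (I : Type) (l : seq I) (P : pred I) (f : I -> fps R) n :
  coefps (\sum_(i <- l | P i) f i) n = \sum_(i <- l | P i) coefps (f i) n.
Proof. by elim/big_rec2: _ => // i y x _ <-. Qed.

Lemma coefps_XM (f : fps R) n :
  coefps (t * f) n = if n is m.+1 then coefps f m else 0.
Proof.
rewrite /=; case: n => [|n]; first by rewrite big_ord1 mul0r.
rewrite big_ord_recl mul0r add0r big_ord_recl mul1r subn1 big1 ?addr0 //.
by move=> i _; rewrite mul0r.
Qed.

Lemma coefps_XnM (f : fps R) k n :
  coefps (t ^+ k * f) n = if (k <= n)%N then coefps f (n - k) else 0.
Proof.
elim: k n => [|k IHk] n; first by rewrite mul1r subn0.
by rewrite exprS -mulrA coefps_XM; case: n => // n; rewrite IHk.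
Qed.

Lemma coefps_Xn k n : coefps (t ^+ k) n = (n == k)%:R.
Proof.
rewrite -[t ^+ k]mulr1 coefps_XnM /= subn_eq0 [n == k]eqn_leq.
by case: leqP; rewrite ?andbT ?andbF.
Qed.

Lemma mul_geometric_fps k : (0 < k)%N ->
  FPS (fun n => ((k %| n)%N)%:R) * (1 - t ^+ k) = 1.
Proof.
move=> k0; apply: fpsP => n; rewrite mulrC mulrBl mul1r.
rewrite -[LHS]/(coefps _ n - coefps (t ^+ k * _) n) coefps_XnM /=.
case: leqP => [kn|nk]; last first.
  case: n nk => [|n] nk; first by rewrite dvdn0 subr0.
  by rewrite gtnNdvd // subr0.
by rewrite dvdn_subl // subrr; case: n kn => //; rewrite leqNgt k0.
Qed.

Lemma unit_1subXn k : (0 < k)%N -> 1 - t ^+ k \is a GRing.unit.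
Proof. by move=> k0; apply: fps_unitP (mul_geometric_fps k0). Qed.

Lemma inv_1subXn k : (0 < k)%N ->
  (1 - t ^+ k)^-1 = FPS (fun n => ((k %| n)%N)%:R).
Proof.
move=> k0; apply: (mulIr (unit_1subXn k0)).
by rewrite mulVr ?unit_1subXn // mul_geometric_fps.
Qed.

(** Each factor splits as [1 - t ^+ w i] times a geometric sum of length [p]; expanding the product
    of these sums selects one exponent [r i < p] for each [i]. *)
Lemma prod_geometric (s p : nat) (w : 'I_s -> nat) :
  \prod_(i < s) (1 - t ^+ (w i * p)) =
  \prod_(i < s) (1 - t ^+ w i) *
  \sum_(r : {ffun 'I_s -> 'I_p}) t ^+ (\sum_(i < s) w i * r i)%N.
Proof.
under [X in _ * X]eq_bigr => r _ do rewrite expr_sum.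
rewrite -(bigA_distr_bigA (fun i (j : 'I_p) => t ^+ (w i * j))) -big_split /=.
apply: eq_bigr => i _; rewrite exprM -opprB subrX1 -mulNr opprB.
by congr (_ * _); apply: eq_bigr => j _; rewrite exprM.
Qed.

End FpsTheory.

(** The geometric series runs over all multiples [a * p]; removing those with [a] a gap leaves the
    series of the semigroup with exponents scaled by [p]. *)
Lemma coefps_gaps (s p : nat) (w : 'I_s -> nat) n : (0 < p)%N ->
  finite_set (gaps w) ->
  coefps ((1 - fpsX int ^+ p)^-1 - \sum_(a \in gaps w) fpsX int ^+ (a * p)) n =
  (`[< exists2 a, semigroup_gen w a & n = (a * p)%N >])%:R.
Proof.
move=> p0 fin_gaps; rewrite inv_1subXn // fsbig_finite //=.
rewrite coefps_sum; under eq_bigr => a _ do rewrite coefps_Xn.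
have [/dvdnP[a ->]|pn] := boolP (p %| n)%N; last first.
  rewrite big1 ?subr0 => [|a _]; last by case: eqP pn => // ->; rewrite dvdn_mull.
  by rewrite asboolF // => -[a _ na]; rewrite na dvdn_mull in pn.
under eq_bigr => b _ do rewrite eqn_pmul2r // eq_sym.
have -> : `[< exists2 b, semigroup_gen w b & (a * p)%N = (b * p)%N >] = `[< semigroup_gen w a >].
  apply/asbool_equiv_eq; split=> [[b Qb /eqP]|Qa]; last by exists a.
  by rewrite eqn_pmul2r // => /eqP ->.
have [Qa|Ga] := asboolP (semigroup_gen w a).
  rewrite big_seq big1 ?subr0 // => b.
  by rewrite in_fset_set // inE => Gb; case: eqP => // ba; rewrite ba in Gb.
rewrite (bigD1_seq a) ?eqxx /= ?finmap.fset_uniq ?in_fset_set ?inE //.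
by rewrite big1 ?addr0 ?subrr // => b /negPf ->.
Qed.

Theorem theorem3p8 (K : finFieldType) (s : nat) (w : 'I_s -> nat)
    (hs : (1 <= s)%N)
    (hw : forall i : 'I_s, (0 < w i)%N)
    (hgcd : \big[gcdn/0%N]_(i < s) w i = 1%N) :
  let q := #|K| in
  let t : fps int := fpsX int in
  hilbert_series (wtorus K w) =
    ((1 - t ^+ (q - 1))^-1 - \sum_(a \in gaps w) t ^+ (a * (q - 1)))
    * (\prod_(i < s) (1 - t ^+ (w i * (q - 1))))
    / \prod_(i < s) (1 - t ^+ w i).
Proof.
move=> q t; have q1 := card_finNzRing_gt1 K : (1 < q)%N.
have p0 : (0 < q - 1)%N by rewrite subn_gt0.
(* The denominator cancels, leaving the semigroup series times the sum of [t ^+ (\sum_i w i * r i)]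
   over all residue vectors [r]. *)
rewrite prod_geometric mulrCA mulrC mulKr; last first.
  by apply: rpred_prod => i _; apply: unit_1subXn.
apply: fpsP => d; rewrite mulr_sumr coefps_sum [LHS]/= dimension_graded_piece //.
rewrite -natz -sum1_card natr_sum big_mkcond.
apply: eq_bigr => r _; rewrite mulrC coefps_XnM (coefps_gaps _ p0 (finite_gaps hgcd)).
(* Coefficient [d] thus counts the [r] for which the rest of the degree is [q - 1] times an element
   of the semigroup; the inequality guards the truncated subtraction. *)
have -> : (r \in attained_residues (q - 1) d w) = (\sum_(i < s) w i * r i <= d)%N &&
    `[< exists2 a, semigroup_gen w a & (d - \sum_(i < s) w i * r i = a * (q - 1))%N >].
  rewrite inE; apply/asboolP/andP => [[c dE] | [rd /asboolP[_ [c ->] dE]]].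
    have {}dE : d = ((\sum_i c i * w i) * (q - 1) + \sum_i w i * r i)%N.
      rewrite dE big_distrl -big_split; apply: eq_bigr => i _ /=.
      by rewrite mulnDr mulnA (mulnC (w i) (c i)).
    rewrite {1}dE leq_addl; split=> //; apply/asboolP.
    exists (\sum_i c i * w i)%N; first by exists c.
    by rewrite dE addnK.
  exists c; rewrite -[LHS](subnK rd) dE big_distrl -big_split.
  by apply: eq_bigr => i _ /=; rewrite mulnDr mulnA (mulnC (w i) (c i)).
by case: leqP => //= _; case: asboolP.
Qed.
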